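(* Let $\bar{A}\in\{0,\star\}^{n\times n}$ be a symmetrically structured matrix with term rank $\mathrm{t\text{-}rank}(\bar{A})=k$. Then there exists a proper variety $V_1\subset\mathbb{R}^{n_{\bar{A}}}$ such that every numerical realization $\tilde{A}$ of $\bar{A}$ whose parameter vector satisfies $\mathbf{p}_{\tilde{A}}\in\mathbb{R}^{n_{\bar{A}}}\setminus V_1$ has $k$ nonzero simple eigenvalues.
   Context: A symmetrically structured matrix $\bar{A}\in\{0,\star\}^{n\times n}$ is a matrix each of whose entries is a fixed zero or a free real parameter $\star$, such that $[\bar{A}]_{ij}=\star$ if and only if $[\bar{A}]_{ji}=\star$, where the parameter at $(i,j)$ is constrained to take the same value as the one at $(j,i)$ and the parameters are otherwise independent. $n_{\bar{A}}$ is the number of independent free parameters of $\bar{A}$. A numerical realization $\tilde{A}$ is obtained by assigning real numbers to the independent free parameters (so $\tilde{A}$ is real symmetric), and $\mathbf{p}_{\tilde{A}}\in\mathbb{R}^{n_{\bar{A}}}$ is the vector of the assigned values. The term rank $\mathrm{t\text{-}rank}(\bar{A})$ is the largest integer $k$ such that there are distinct rows $i_1,\dots,i_k$ and distinct columns $j_1,\dots,j_k$ with $[\bar{A}]_{i_\ell j_\ell}=\star$ for all $\ell=1,\dots,k$. A variety in $\mathbb{R}^N$ is the set of common zeros in $\mathbb{R}^N$ of finitely many real polynomials; it is proper if it is not all of $\mathbb{R}^N$. *)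

(* Defs.v *)
From mathcomp Require Import all_boot all_order all_algebra.
From mathcomp Require Import reals.
From mathcomp Require Import mpoly.

Set Implicit Arguments.
Unset Strict Implicit.
Unset Printing Implicit Defensive.

Import Order.TTheory GRing.Theory Num.Theory.
Local Open Scope ring_scope.

(* A structured matrix is a boolean matrix, [true] standing for a free
   parameter and [false] for a fixed zero. *)
Definition sym_structured (n : nat) (A : 'M[bool]_n) : Prop :=
  forall i j, A i j = A j i.

Definition has_star_matching (n : nat) (A : 'M[bool]_n) (k : nat) : bool :=
  [exists r : {ffun 'I_k -> 'I_n}, exists c : {ffun 'I_k -> 'I_n},
    [&& injectiveb r, injectiveb c & [forall l, A (r l) (c l)]]].

Definition term_rank (n : nat) (A : 'M[bool]_n) : nat :=
  (\max_(k < n.+1 | has_star_matching A k) k)%N.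

(* The bound [k < n.+1] in [term_rank] discards nothing. *)
Lemma term_rankP (n : nat) (A : 'M[bool]_n) :
  has_star_matching A (term_rank A) /\
  forall k, has_star_matching A k -> (k <= term_rank A)%N.
Proof.
have ub k : has_star_matching A k -> (k < n.+1)%N.
  move=> /existsP[r] /existsP[c] /and3P[/injectiveP r_inj _ _].
  by have := leq_card r r_inj; rewrite !card_ord ltnS.
have h0 : has_star_matching A (ord0 : 'I_n.+1).
  pose w := finfun (widen_ord (leq0n n)).
  apply/existsP; exists w; apply/existsP; exists w.
  by apply/and3P; split; [apply/injectiveP=> -[]..|apply/forallP=> -[]].
split.
  rewrite /term_rank (bigop.bigmax_eq_arg ord0) //.
  by case: arg_maxnP.
move=> k hk; exact: (@bigop.leq_bigmax_cond _ _ _ (Ordinal (ub k hk))).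
Qed.

(* The entries (i, j) and (j, i) carry one parameter, indexed by the position
   on or above the diagonal. *)
Definition param (n : nat) (A : 'M[bool]_n) : finType :=
  {ij : 'I_n * 'I_n | (ij.1 <= ij.2)%N && A ij.1 ij.2}.

Definition nparam (n : nat) (A : 'M[bool]_n) : nat := #|param A|.

Definition upper_pos (n : nat) (i j : 'I_n) : 'I_n * 'I_n :=
  if (i <= j)%N then (i, j) else (j, i).

Definition realization (R : realType) (n : nat) (A : 'M[bool]_n)
    (p : 'rV[R]_(nparam A)) : 'M[R]_n :=
  \matrix_(i, j)
    if insub (upper_pos i j) is Some t then p 0 (enum_rank (t : param A)) else 0.

(* Realizations are exactly the symmetric matrices vanishing at the fixed
   zeros. *)
Lemma realizationP (R : realType) (n : nat) (A : 'M[bool]_n) (M : 'M[R]_n) :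
  sym_structured A ->
  (exists p : 'rV[R]_(nparam A), M = realization p) <->
  (forall i j, M i j = M j i) /\ (forall i j, ~~ A i j -> M i j = 0).
Proof.
move=> A_sym; have upC i j : @upper_pos n i j = upper_pos j i.
  rewrite /upper_pos; case: (ltngtP i j) => // /val_inj -> //.
have upA i j : ((upper_pos i j).1 <= (upper_pos i j).2)%N
               && A (upper_pos i j).1 (upper_pos i j).2 = A i j.
  by rewrite /upper_pos; case: (leqP i j) => /= h; rewrite ?h // ltnW //= A_sym.
split=> [[p ->]|[M_sym M_zero]].
  split=> i j; first by rewrite !mxE upC.
  by rewrite !mxE => Aij; rewrite insubN // upA.
exists (\row_t M (val (enum_val t)).1 (val (enum_val t)).2).
apply/matrixP=> i j; rewrite mxE; case: insubP => [t _ tE|].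
  rewrite mxE enum_rankK tE /upper_pos.
  by case: leqP => //= _; rewrite M_sym.
by rewrite upA; exact: M_zero.
Qed.

Definition variety (R : realType) (N : nat) (V : 'rV[R]_N -> Prop) : Prop :=
  exists s : seq {mpoly R[N]},
    forall x, V x <-> (forall f, f \in s -> f.@[fun i => x 0 i] = 0).

Definition proper_variety (R : realType) (N : nat) (V : 'rV[R]_N -> Prop) :
    Prop :=
  variety V /\ exists x, ~ V x.

(* Multiplicity is algebraic, i.e. as a root of the characteristic
   polynomial. *)
Definition simple_eigenvalue (R : realType) (n : nat) (M : 'M[R]_n) (a : R) :
    bool :=
  eigenvalue M a && (mup a (char_poly M) == 1%N).

Definition has_nonzero_simple_eigenvalues (R : realType) (n : nat)
    (M : 'M[R]_n) (k : nat) : Prop :=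
  exists s : seq R, [/\ uniq s, size s = k &
    forall a, (a \in s) = (a != 0) && simple_eigenvalue M a].

(* Main.v *)
(* Real symmetric matrices have real spectrum and nonzero eigenvalues counted
   by the rank, and the rank of a realization is at most the term rank k. Hence
   the characteristic polynomial is 'X^(n - k) * q with q monic of degree k, and
   the conclusion holds as soon as 'X * q is separable, i.e. outside the zero
   set of the resultant of 'X * q and its derivative, a polynomial in the
   parameters.

   This set is proper because some realization has k distinct nonzero
   eigenvalues. A realization of rank k is built by induction on a maximum
   matching, seen as a set of arcs i -> j: pivoting on the symmetric pair of
   entries (i, j), (j, i) either removes at most two arcs or replaces a path
   h -> i -> j -> l by a single arc h -> l, whose weight can be prescribed.
   Scaling it to D M D with D diagonal keeps the pattern, so it suffices that a
   nonsingular symmetric B can be scaled to have distinct eigenvalues. By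
   induction this holds for a nonsingular principal submatrix of corank one or
   two, and one perturbs the corresponding D, padded by zeros. In corank one the
   padding adds a simple zero eigenvalue. Corank two is needed only when all
   principal minors of corank one vanish; then the linear coefficient of the
   characteristic polynomial of D B D vanishes for every D, so that the double
   zero eigenvalue splits for every nearby nonsingular D. *)
Require Import Defs.
From mathcomp Require Import all_boot all_order all_algebra.
From mathcomp Require Import perm separable reals complex.
From mathcomp Require Import mpoly.
From mathcomp Require Import ring.

Set Implicit Arguments.
Unset Strict Implicit.
Unset Printing Implicit Defensive.

Import Order.TTheory GRing.Theory Num.Theory.
Local Open Scope ring_scope.

(** * Characteristic polynomial and rank of real symmetric matrices *)

Lemma char_poly_conj (F : fieldType) n (P M : 'M[F]_n) :
  P \in unitmx -> char_poly (invmx P *m M *m P) = char_poly M.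
Proof.
move=> P_unit; rewrite /char_poly /char_poly_mx.
have PVK : map_mx polyC (invmx P) *m map_mx polyC P = 1%:M.
  by rewrite -map_mxM mulVmx // map_mx1.
have -> : 'X%:M - map_mx polyC (invmx P *m M *m P)
        = map_mx polyC (invmx P) *m ('X%:M - map_mx polyC M) *m map_mx polyC P.
  rewrite !map_mxM mulmxBr mulmxBl scalar_mxC -(mulmxA 'X%:M).
  by rewrite PVK mulmx1.
by rewrite !det_mulmx mulrAC -det_mulmx PVK det1 mul1r.
Qed.

Lemma rank_mxsub_le (F : fieldType) m n m' n' (f : 'I_m' -> 'I_m)
    (g : 'I_n' -> 'I_n) (M : 'M[F]_(m, n)) : (\rank (mxsub f g M) <= \rank M)%N.
Proof.
rewrite mxsubrc; apply: leq_trans (mxrankS (rowsub_sub _ _)) _.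
by rewrite -mxrank_tr trmx_mxsub -(mxrank_tr M) mxrankS // rowsub_sub.
Qed.

Lemma rank_diag_mx_ge (F : fieldType) n (d : 'rV[F]_n) :
  (#|[pred i | d 0%R i != 0%R]| <= \rank (diag_mx d))%N.
Proof.
pose f (i : 'I_#|[pred i | d 0%R i != 0%R]|) := enum_val i.
apply: leq_trans (rank_mxsub_le f f _).
have -> : mxsub f f (diag_mx d) = diag_mx (\row_i d 0 (f i)).
  by apply/matrixP=> i j; rewrite !mxE (inj_eq enum_val_inj).
rewrite mxrank_unit // unitmxE det_diag unitfE; apply/prodf_neq0=> i _.
by rewrite mxE; exact: (enum_valP i).
Qed.

Section Spectrum.
Variable R : rcfType.

(** The spectral theorem over [R[i]] diagonalizes [M] with real eigenvalues. Both claims descend to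
    [R] because the embedding is injective on polynomials and preserves rank. *)
Lemma symmetric_char_poly n (M : 'M[R]_n) : M^T = M ->
  exists2 d : 'rV[R]_n, char_poly M = \prod_i ('X - (d 0 i)%:P)
                      & (#|[pred i | d 0%R i != 0%R]| <= \rank M)%N.
Proof.
move=> M_sym; pose toC := real_complex R; pose Mc := map_mx toC M.
have Mc_herm : (Mc \is hermitianmx _ false Num.conj).
  apply: realsym_hermsym; first apply/is_hermitianmxP.
    by rewrite expr0 scale1r map_mx_id // map_trmx M_sym.
  by apply/mxOverP=> i j; rewrite mxE; apply/complex_realP; exists (M i j).
have := hermitian_normalmx Mc_herm; move/orthomx_spectralP.
have := hermitian_spectral_diag_real Mc_herm.
set sp := spectral_diag Mc; set P := spectralmx Mc => sp_real McE.
have P_unit : P \in unitmx := spectral_unit Mc.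
pose d := map_mx (@complex.Re R) sp.
have spE : sp = map_mx toC d.
  by apply/rowP=> i; rewrite !mxE; apply/esym/RRe_real;
    have /mxOverP := sp_real; apply.
exists d.
  apply: (map_inj_poly (f := toC)); [exact: complexI|exact: rmorph0|].
  rewrite map_char_poly -/Mc McE char_poly_conj //.
  rewrite char_poly_trig ?diag_mx_is_trig // rmorph_prod; apply: eq_bigr => i _.
  by rewrite rmorphB /= map_polyX map_polyC /= !mxE eqxx spE mxE.
rewrite -(mxrank_map toC) -/Mc McE mxrankMfree ?row_free_unit //.
by rewrite eqmxMfull ?row_full_unit ?unitmx_inv //
  spE -map_diag_mx mxrank_map rank_diag_mx_ge.
Qed.

Lemma symmetric_char_polyX n (M : 'M[R]_n) : M^T = M ->
  exists u : seq R, [/\ 0 \notin u, (size u <= \rank M)%N &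
    char_poly M = 'X^(n - size u) * \prod_(a <- u) ('X - a%:P)].
Proof.
move=> /symmetric_char_poly[d charE d_rank].
pose t := [seq d 0 i | i <- enum 'I_n].
exists [seq a <- t | a != 0]; split.
- by rewrite mem_filter eqxx.
- rewrite size_filter count_map; apply: leq_trans d_rank.
  by rewrite cardE [X in (_ <= X)%N]size_filter enumT eq_leq.
have szt : size t = n by rewrite size_map size_enum_ord.
have -> : char_poly M = \prod_(a <- t) ('X - a%:P).
  by rewrite charE big_map big_enum.
rewrite -{1}szt size_filter -(count_predC (fun a => a != 0)) addKn.
elim: t {szt} => [|a t IHt]; first by rewrite !big_nil mul1r.
rewrite big_cons IHt /=; have [->|_] /= := eqVneq a 0.
  by rewrite subr0 add1n exprS mulrA.
by rewrite add0n big_cons mulrCA.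
Qed.
End Spectrum.

(** * Symmetric matrices of large rank supported on a matching *)

(** On either side, multiplication by [P] fixes [A] and kills [B]. On the left this puts the row
    spaces of [A] and [B] inside that of [A + B]; on the right it makes these two row spaces meet
    only in 0. *)
Lemma rank_add_ortho_ge (F : fieldType) n (P A B : 'M[F]_n) :
    P *m A = A -> A *m P = A -> P *m B = 0 -> B *m P = 0 ->
  (\rank A + \rank B <= \rank (A + B)%R)%N.
Proof.
move=> PA AP PB BP; have sA : (A <= (A + B)%R)%MS.
  by have := submxMl P (A + B); rewrite mulmxDr PA PB addr0.
have sB : (B <= (A + B)%R)%MS.
  have := addmx_sub (_ : ((- A)%R <= (A + B)%R)%MS) (submx_refl (A + B)).
  by rewrite addKr eqmx_opp; apply.
rewrite -mxrank_disjoint_sum ?mxrankS ?addsmx_sub ?sA ?sB //.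
apply/eqP/rowV0P=> v; rewrite sub_capmx => /andP[/submxP[x vA] /submxP[y vB]].
by rewrite vA -AP mulmxA -vA vB -mulmxA BP mulmx0.
Qed.

Lemma swap_mx_neq0 (F : fieldType) n (u v x y : 'I_n) :
    (delta_mx u v + delta_mx v u : 'M[F]_n) x y != 0 ->
  (x, y) = (u, v) \/ (x, y) = (v, u).
Proof.
rewrite !mxE -!xpair_eqE; have [->|_] := eqVneq (x, y) (u, v); first by left.
have [->|_] := eqVneq (x, y) (v, u); first by right.
by rewrite addr0 eqxx.
Qed.

Lemma tr_swap_mx (F : fieldType) n (u v : 'I_n) :
  (delta_mx u v + delta_mx v u : 'M[F]_n)^T = delta_mx u v + delta_mx v u.
Proof. by rewrite linearD /= !trmx_delta addrC. Qed.

Lemma rank_swap_ge (F : fieldType) n (i j : 'I_n) : i != j ->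
  (2 <= \rank (delta_mx i j + delta_mx j i : 'M[F]_n)%R)%N.
Proof.
move=> i_neq_j; set J := _ + _.
have JJ : J *m J = delta_mx i i + delta_mx j j.
  rewrite /J mulmxDl !mulmxDr !mul_delta_mx_cond !eqxx (negPf i_neq_j).
  by rewrite eq_sym (negPf i_neq_j) !mulr0n add0r addr0.
apply: leq_trans (mxrankM_maxl J J); rewrite JJ.
apply: leq_trans (rank_add_ortho_ge (P := delta_mx i i) _ _ _ _);
  rewrite ?mxrank_delta // mul_delta_mx_cond ?eqxx ?(negPf i_neq_j) //.
by rewrite eq_sym (negPf i_neq_j).
Qed.

Lemma mul_delta_row0 (F : fieldType) n (M : 'M[F]_n) (i k : 'I_n) :
  (forall j, M i j = 0) -> delta_mx k i *m M = 0.
Proof.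
move=> Mi; rewrite -(mul_delta_mx (0 : 'I_1)) -mulmxA -rowE.
by rewrite (_ : row i M = 0) ?mulmx0 //; apply/rowP=> j; rewrite !mxE.
Qed.

Lemma mul_delta_col0 (F : fieldType) n (M : 'M[F]_n) (i k : 'I_n) :
  (forall j, M j i = 0) -> M *m delta_mx i k = 0.
Proof.
move=> Mi; apply: trmx_inj; rewrite trmx_mul trmx_delta trmx0.
by rewrite mul_delta_row0 // => j; rewrite mxE.
Qed.

Lemma rank_swap_add_ge (F : fieldType) n (M : 'M[F]_n) (i j : 'I_n) :
    i != j -> (forall k, M i k = 0) -> (forall k, M j k = 0) ->
    (forall k, M k i = 0) -> (forall k, M k j = 0) ->
  (2 + \rank M <= \rank (delta_mx i j + delta_mx j i + M)%R)%N.
Proof.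
move=> i_neq_j Mi_ Mj_ M_i M_j; have j_neq_i : j != i by rewrite eq_sym.
pose P : 'M[F]_n := delta_mx i i + delta_mx j j.
apply: leq_trans (leq_add (rank_swap_ge F i_neq_j) (leqnn _)) _.
apply: (rank_add_ortho_ge (P := P)).
- rewrite mulmxDl !mulmxDr !mul_delta_mx_cond !eqxx (negPf i_neq_j) (negPf j_neq_i).
  by rewrite !mulr0n !mulr1n addr0 add0r.
- rewrite mulmxDl !mulmxDr !mul_delta_mx_cond !eqxx (negPf i_neq_j) (negPf j_neq_i).
  by rewrite !mulr0n !mulr1n addr0 add0r.
- by rewrite mulmxDl !mul_delta_row0 ?addr0.
- by rewrite mulmxDr !mul_delta_col0 ?addr0.
Qed.

(* Eliminating the pivots (i, j) and (j, i) leaves the Schur complement, in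
   which the path h - i - j - l has been contracted to an edge h - l. *)
Lemma rank_contraction_le (F : fieldType) n (M : 'M[F]_n) (i j h l : 'I_n) b :
    i != j -> h != i -> h != j -> l != i -> l != j ->
    (forall k, M i k = 0) -> (forall k, M j k = 0) ->
    (forall k, M k i = 0) -> (forall k, M k j = 0) ->
  (\rank (delta_mx i j + delta_mx j i +
            (M - b *: (delta_mx l h + delta_mx h l)))%R
    <= \rank (delta_mx i j + delta_mx j i +
            (M + (delta_mx j l + delta_mx l j)
             + b *: (delta_mx i h + delta_mx h i)))%R)%N.
Proof.
move=> ij hi hj li lj Mi_ Mj_ M_i M_j.
set N := (X in (_ <= \rank X)%N); set N' := (X in (\rank X <= _)%N).
(* Left multiplication by [U] subtracts row i from row l and b times row j from row h: the entries
   (l, j) and (h, i) are cleared, and -b is added at (l, h) and at (h, l). Then [U^T] clears (j, l)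
   and (i, h) by the same operations on columns. *)
pose U : 'M[F]_n := 1%:M - delta_mx l i - b *: delta_mx h j.
suff -> : N' = U *m N *m U^T.
  by apply: leq_trans (mxrankM_maxl _ _) _; exact: mxrankM_maxr.
have neqs : ((i == j) = false) * ((j == i) = false) * ((h == i) = false)
  * ((i == h) = false) * ((h == j) = false) * ((j == h) = false)
  * ((l == i) = false) * ((i == l) = false) * ((l == j) = false) * ((j == l) = false).
  rewrite ![i == _]eq_sym ![j == h]eq_sym ![j == l]eq_sym.
  by rewrite !(negPf hi, negPf hj, negPf li, negPf lj) eq_sym (negPf ij).
have rowi : delta_mx l i *m N = delta_mx l j + b *: delta_mx l h.
  rewrite /N !(mulmxDr, linearZ) /= !mulmxDr !mul_delta_mx_cond !neqs !eqxx.
  by rewrite (mul_delta_row0 _ Mi_) !mulr0n !mulr1n !(addr0, add0r).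
have rowj : delta_mx h j *m N = delta_mx h i + delta_mx h l.
  rewrite /N !(mulmxDr, linearZ) /= !mulmxDr !mul_delta_mx_cond !neqs !eqxx.
  by rewrite (mul_delta_row0 _ Mj_) !mulr0n !mulr1n !(addr0, add0r, scaler0).
pose K := delta_mx i j + delta_mx j i + M + delta_mx j l + b *: delta_mx i h
          - b *: delta_mx l h - b *: delta_mx h l.
have UN : U *m N = K.
  rewrite /U !mulmxBl mul1mx -scalemxAl rowi rowj /N /K.
  by apply/matrixP=> x y; rewrite !mxE; ring.
have coli : K *m delta_mx i l = delta_mx j l.
  rewrite /K !(mulmxDl, mulNmx) -!scalemxAl !mul_delta_mx_cond !neqs !eqxx.
  by rewrite (mul_delta_col0 _ M_i) !mulr0n !mulr1n !(addr0, add0r, scaler0, subr0).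
have colj : K *m delta_mx j h = delta_mx i h.
  rewrite /K !(mulmxDl, mulNmx) -!scalemxAl !mul_delta_mx_cond !neqs !eqxx.
  by rewrite (mul_delta_col0 _ M_j) !mulr0n !mulr1n !(addr0, add0r, scaler0, subr0).
have -> : U^T = 1%:M - delta_mx i l - b *: delta_mx j h.
  by rewrite /U !linearB /= linearZ /= trmx1 !trmx_delta.
rewrite UN !mulmxBr mulmx1 -scalemxAr.
rewrite coli colj /N' /K; apply/matrixP=> x y; rewrite !mxE; ring.
Qed.

Lemma rank_symmetric_matching (F : numFieldType) n (E : {set 'I_n * 'I_n}) :
    {in E &, injective fst} -> {in E &, injective snd} ->
  exists M : 'M[F]_n, [/\ M^T = M,
    forall i j, M i j != 0 -> ((i, j) \in E) || ((j, i) \in E)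
    & (#|E| <= \rank M)%N].
Proof.
have [m] := ubnP #|E|; elim: m E => // m IHm E; rewrite ltnS => Em E_fst E_snd.
have [->|/set0Pn[[i j] Eij]] := eqVneq E set0.
  by exists 0; rewrite trmx0 cards0; split=> // i j; rewrite mxE eqxx.
pose E2 := [set e in E | [&& e.1 != i, e.1 != j, e.2 != i & e.2 != j]].
have sE2 : {subset E2 <= E} by move=> e; rewrite inE => /andP[].
have E2N e : e \in E2 -> [&& e.1 != i, e.1 != j, e.2 != i & e.2 != j].
  by rewrite inE => /andP[].
have ltE2 : (#|E2| < #|E|)%N.
  apply: proper_card; apply/properP; split; first exact/subsetP.
  by exists (i, j) => //; rewrite inE /= eqxx andbF.
have E2_fst : {in E2 &, injective fst} by move=> e f /sE2 ? /sE2 ?; exact: E_fst.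
have E2_snd : {in E2 &, injective snd} by move=> e f /sE2 ? /sE2 ?; exact: E_snd.
have out_i e : e \in E -> e.1 = i -> e = (i, j).
  by move=> Ee e1; apply: E_fst.
have in_j e : e \in E -> e.2 = j -> e = (i, j).
  by move=> Ee e1; apply: E_snd.
have zero_col (M : 'M[F]_n) k : M^T = M -> (forall l, M k l = 0) ->
    forall l, M l k = 0.
  by move=> M_sym Mk l; rewrite -M_sym mxE.
(* No other arc leaves i or enters j, so besides (i, j) the arcs lost from [E] to [E2] all leave j
   or enter i; [S] is any set containing these. *)
have card_cover (S : {set 'I_n * 'I_n}) :
    (forall e, e \in E -> e != (i, j) -> (e.1 == j) || (e.2 == i) -> e \in S) ->
  (#|E| <= 1 + #|S| + #|E2|)%N.
  move=> coverS; rewrite -(cards1 (i, j)).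
  have -> : E = ([set (i, j)] :|: S :&: E) :|: E2.
    apply/setP=> e; rewrite !in_setU in_set1 in_setI.
    have [->|e_neq] /= := eqVneq e (i, j); first by rewrite Eij.
    have [Ee|eNE] := boolP (e \in E); last first.
      by rewrite andbF; apply/esym/negbTE; apply: contra eNE => /sE2.
    rewrite andbT; apply/esym/orP.
    have [|] := boolP ((e.1 == j) || (e.2 == i)); first by left; apply: coverS.
    rewrite negb_or => /andP[e1j e2i]; right.
    rewrite inE Ee e1j e2i /=.
    by apply/andP; split; apply: contra_neqN e_neq => /eqP;
      [apply: out_i|apply: in_j].
  apply: leq_trans (leq_card_setU _ _).1 _; rewrite leq_add2r.
  apply: leq_trans (leq_card_setU _ _).1 _; rewrite leq_add2l.
  exact/subset_leq_card/subsetIl.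
(* A loop is the only arc lost, and the diagonal entry (i, i) restores its unit of rank. *)
have [eq_ij|i_neq_j] := eqVneq i j.
  subst j.
  have [M [M_sym M_supp M_rank]] := IHm _ (leq_trans ltE2 Em) E2_fst E2_snd.
  have Mi k : M i k = 0.
    apply/eqP/contraT=> /M_supp /orP[] /E2N /=; by rewrite eqxx ?andbF.
  have cardE : (#|E| <= 1 + #|E2|)%N.
    have := card_cover set0; rewrite cards0 addn0; apply=> e Ee e_neq.
    by case/orP=> /eqP ei; case/eqP: e_neq; [apply: out_i|apply: in_j].
  exists (delta_mx i i + M); split.
  - by rewrite linearD /= trmx_delta M_sym.
  - move=> x y; rewrite !mxE; have [Mxy|/M_supp] := eqVneq (M x y) 0; last first.
      by move=> /orP[] /sE2 ->; rewrite ?orbT.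
    by rewrite Mxy addr0 pnatr_eq0 eqb0 negbK => /andP[/eqP-> /eqP->]; rewrite Eij.
  - have := rank_add_ortho_ge (P := delta_mx i i) (A := delta_mx i i) (B := M).
    rewrite mxrank_delta !mul_delta_mx mul_delta_row0 // mul_delta_col0;
      last exact: zero_col.
    move=> /(_ erefl erefl erefl erefl); apply: leq_trans.
    exact: leq_trans cardE (leq_add _ M_rank).
have j_neq_i : j != i by rewrite eq_sym.
(* With h distinct from j, both ends of the path h -> i -> j -> l avoid i and j. Three arcs are
   lost; the contracted arc (h, l) and the two pivots make up for them. The 2-cycle h = j falls
   under the last case. *)
have [[h l] /= /and3P[Ehi Ejl h_neq_j]|no_path] :=
    pickP [pred hl | [&& (hl.1, i) \in E, (j, hl.2) \in E & hl.1 != j]].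
  have h_neq_i : h != i.
    by apply/eqP=> hi; have [_ /eqP] := out_i _ Ehi hi; rewrite (negPf i_neq_j).
  have l_neq_j : l != j.
    by apply/eqP=> lj; have [/eqP] := in_j _ Ejl lj; rewrite (negPf j_neq_i).
  have l_neq_i : l != i.
    apply/eqP=> li; have [] : (h, i) = (j, l) by apply: E_snd.
    by move/eqP; rewrite (negPf h_neq_j).
  have hlNE2 : (h, l) \notin E2.
    apply/negP=> hlE2; have [li] : (h, l) = (h, i) by apply: E_fst => //; exact: sE2.
    by rewrite li eqxx in l_neq_i.
  have cardE : (#|E| <= 2 + #|(h, l) |: E2|)%N.
    rewrite cardsU1 hlNE2 !addnA.
    apply: leq_trans (card_cover [set (h, i); (j, l)] _) _.
      move=> e Ee _ /orP[] /eqP ej; rewrite !inE.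
        by rewrite (E_fst e (j, l)) ?eqxx ?orbT.
      by rewrite (E_snd e (h, i)) ?eqxx.
    by rewrite leq_add2r !addnS addn0 ltnS cards2; case: eqP.
  have [|||M [M_sym M_supp M_rank]] := IHm ((h, l) |: E2).
  - rewrite cardsU1 hlNE2; apply: leq_trans _ Em.
    have ijNE2 : (i, j) \notin (j, l) |: E2.
      by rewrite !inE /= eqxx andbF orbF xpair_eqE (negPf i_neq_j).
    have jlNE2 : (j, l) \notin E2 by rewrite !inE /= eqxx !andbF.
    have := subset_leq_card (_ : (i, j) |: ((j, l) |: E2) \subset E).
    rewrite !cardsU1 ijNE2 jlNE2; apply.
    by rewrite !subUset !sub1set Eij Ejl; apply/subsetP.
  - move=> e f; rewrite !in_setU1.
    case: eqP => [->|_] /=; case: eqP => [->|_] //=.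
    + move=> _ f2 hf; have := E2N f f2.
      by rewrite (E_fst f (h, i) (sE2 _ f2) Ehi (esym hf)) /= eqxx ?andbF.
    + move=> f2 _ hf; have := E2N e f2.
      by rewrite (E_fst e (h, i) (sE2 _ f2) Ehi (hf)) /= eqxx ?andbF.
    + exact: E2_fst.
  - move=> e f; rewrite !in_setU1.
    case: eqP => [->|_] /=; case: eqP => [->|_] //=.
    + move=> _ f2 hf; have := E2N f f2.
      by rewrite (E_snd f (j, l) (sE2 _ f2) Ejl (esym hf)) /= eqxx ?andbF.
    + move=> f2 _ hf; have := E2N e f2.
      by rewrite (E_snd e (j, l) (sE2 _ f2) Ejl (hf)) /= eqxx ?andbF.
    + exact: E2_snd.
  have M_row k : (k == i) || (k == j) -> forall x, M k x = 0.
    move=> k_ij x; apply/eqP/contraT=> /M_supp; rewrite !in_setU1.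
    case/orP=> /orP[/eqP[kE xE]|/E2N /=].
    + by move: k_ij; rewrite kE (negPf h_neq_i) (negPf h_neq_j).
    + by case/orP: k_ij => /eqP->; rewrite eqxx ?andbF.
    + by move: k_ij; rewrite xE (negPf l_neq_i) (negPf l_neq_j).
    + by case/orP: k_ij => /eqP->; rewrite eqxx ?andbF.
  (* The weight b cancels the entry (h, l) of [M], because (h, l) need not lie in [E]; the
     contraction lemma gives this entry back. When h = l the entry of [D] there is 2, hence the
     halving. *)
  pose b := if h == l then - (M h l / 2%:R) else - M h l.
  pose D : 'M[F]_n := delta_mx l h + delta_mx h l.
  have D_sym : D^T = D by exact: tr_swap_mx.
  have D_off x y : D x y != 0 -> (x, y) = (h, l) \/ (x, y) = (l, h).
    by move/swap_mx_neq0=> [->|->]; auto.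
  have D_row k : (k == i) || (k == j) -> forall x, D k x = 0.
    move=> k_ij x; apply/eqP/contraT=> /D_off[] [kE _]; move: k_ij; rewrite kE.
      by rewrite (negPf h_neq_i) (negPf h_neq_j).
    by rewrite (negPf l_neq_i) (negPf l_neq_j).
  pose M2 := M + b *: D.
  have M2_sym : M2^T = M2 by rewrite linearD /= linearZ /= M_sym D_sym.
  have M2_row k : (k == i) || (k == j) -> forall x, M2 k x = 0.
    by move=> k_ij x; rewrite mxE [X in _ + X]mxE M_row // D_row // mulr0 addr0.
  have M2hl : M2 h l = 0.
    rewrite !mxE /b !eqxx; have [->|hl] := eqVneq h l; rewrite ?eqxx /=.
      by field.
    by rewrite add0r mulr1 subrr.
  have M2lh : M2 l h = 0 by rewrite -M2_sym mxE.
  have M2_supp x y : M2 x y != 0 -> ((x, y) \in E) || ((y, x) \in E).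
    have [[-> ->]|xy_hl] := eqVneq (x, y) (h, l); first by rewrite M2hl eqxx.
    have [[-> ->]|xy_lh] := eqVneq (x, y) (l, h); first by rewrite M2lh eqxx.
    have -> : M2 x y = M x y.
      rewrite mxE [X in _ + X]mxE.
      have [->|/D_off[] /eqP] := eqVneq (D x y) 0; first by rewrite mulr0 addr0.
        by rewrite (negPf xy_hl).
      by rewrite (negPf xy_lh).
    move/M_supp; rewrite !in_setU1 (negPf xy_hl) [(y, x) == _]eq_sym.
    rewrite xpair_eqE andbC [h == y]eq_sym [l == x]eq_sym -xpair_eqE.
    by rewrite (negPf xy_lh) => /orP[] /sE2 ->; rewrite ?orbT.
  exists (delta_mx i j + delta_mx j i + (M2 + (delta_mx j l + delta_mx l j)
          + b *: (delta_mx i h + delta_mx h i))); split.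
  - rewrite linearD [X in _ + X]linearD [X in _ + (X + _)]linearD linearZ /=.
    by rewrite !tr_swap_mx M2_sym.
  - move=> x y; apply: contraR; rewrite negb_or => /andP[xyE yxE].
    have off u v : (u, v) \in E -> (delta_mx u v + delta_mx v u : 'M[F]_n) x y = 0.
      move=> Euv; apply/eqP/contraT=> /swap_mx_neq0[] [xE yE].
        by rewrite xE yE Euv in xyE.
      by rewrite xE yE Euv in yxE.
    have M2xy : M2 x y = 0.
      by apply/eqP/contraT=> /M2_supp; rewrite (negPf xyE) (negPf yxE).
    rewrite mxE off // add0r mxE [X in X + _]mxE M2xy add0r off // add0r mxE.
    by rewrite [delta_mx i h + _]addrC off // mulr0.
  - have M2_col k : (k == i) || (k == j) -> forall x, M2 x k = 0.
      by move=> k_ij; apply/zero_col/M2_row.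
    apply: leq_trans (rank_contraction_le b _ _ _ _ _ _ _ _ _);
      rewrite ?(M2_row, M2_col) ?eqxx ?orbT //; try by
      [apply: M2_row; rewrite eqxx ?orbT | apply: M2_col; rewrite eqxx ?orbT].
    rewrite -/D /M2 addrK; apply: leq_trans cardE _.
    apply: leq_trans (leq_add (leqnn _) M_rank) _.
    by apply: rank_swap_add_ge => //; try (apply: zero_col => //);
      apply: M_row; rewrite eqxx ?orbT.
(* Without such a path at most one further arc is lost: if some (h, i) is in [E], an arc leaving j
   forces h = j and is then (j, i) itself. So at most two arcs go, which the rank 2 of the swap
   block compensates. When no further arc exists, the choice of [x] is arbitrary. *)
have [x coverx] : exists x, forall e, e \in E -> e != (i, j) ->
    (e.1 == j) || (e.2 == i) -> e \in [set x].
  case: (pickP [pred h | (h, i) \in E]) => [h /= Ehi|no_h].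
    exists (h, i) => e Ee e_neq /orP[] /eqP ej; last by rewrite inE; apply/eqP/E_snd.
    move: (no_path (h, e.2)); rewrite /= Ehi -ej -surjective_pairing Ee /=.
    move=> /negbFE/eqP hj.
    by rewrite inE; apply/eqP/E_fst => //=; rewrite hj.
  case: (pickP [pred l | (j, l) \in E]) => [l /= Ejl|no_l].
    exists (j, l) => e Ee e_neq /orP[] /eqP ej; first by rewrite inE; apply/eqP/E_fst.
    by have := no_h e.1; rewrite /= -ej -surjective_pairing Ee.
  exists (i, j) => e Ee e_neq /orP[] /eqP ej.
    by have := no_l e.2; rewrite /= -ej -surjective_pairing Ee.
  by have := no_h e.1; rewrite /= -ej -surjective_pairing Ee.
have cardE := card_cover _ coverx; rewrite cards1 in cardE.
have [M [M_sym M_supp M_rank]] := IHm _ (leq_trans ltE2 Em) E2_fst E2_snd.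
have M_row k : (k == i) || (k == j) -> forall x, M k x = 0.
  move=> k_ij y; apply/eqP/contraT=> /M_supp.
  by case/orP=> /E2N /=; case/orP: k_ij => /eqP->; rewrite eqxx ?andbF.
exists (delta_mx i j + delta_mx j i + M); split.
- by rewrite linearD /= tr_swap_mx M_sym.
- move=> y z; rewrite mxE; have [Myz|/M_supp] := eqVneq (M y z) 0; last first.
    by move=> /orP[] /sE2 ->; rewrite ?orbT.
  by rewrite Myz addr0 => /swap_mx_neq0[] [-> ->]; rewrite Eij ?orbT.
- apply: leq_trans cardE _; apply: leq_trans (leq_add (leqnn _) M_rank) _.
  by apply: rank_swap_add_ge => //; try (apply: zero_col => //);
    apply: M_row; rewrite eqxx ?orbT.
Qed.

(** * Nonsingular submatrices *)

(** A nonsingular submatrix of size [\rank M] has a nonzero term in the Leibniz expansion of its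
    determinant, and the permutation of that term is a matching inside the pattern. *)
Lemma has_star_matching_rank (F : fieldType) n (A : 'M[bool]_n) (M : 'M[F]_n) :
  (forall i j, ~~ A i j -> M i j = 0) -> has_star_matching A (\rank M).
Proof.
move=> M_supp; set f := maxrankfun M.
have B_full : row_full (rowsub f M)^T.
  by rewrite /row_full mxrank_tr; exact: maxrowsub_free.
set g := fullrankfun B_full.
have : mxsub f g M \in unitmx.
  have -> : mxsub f g M = (rowsub g (rowsub f M)^T)^T.
    by apply/matrixP=> i j; rewrite !mxE.
  by rewrite unitmx_tr fullrowsub_unit.
rewrite unitmxE unitfE /determinant => det_neq0.
have /existsP[s s_neq0] :
    [exists s : 'S_(\rank M), \prod_i mxsub f g M i (s i) != 0].
  apply: contraNT det_neq0; rewrite negb_exists => /forallP s0.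
  by rewrite big1 // => s _; rewrite (eqP (negbNE (s0 s))) mulr0.
apply/existsP; exists (finfun f); apply/existsP; exists [ffun i => g (s i)].
apply/and3P; split.
- by apply/injectiveP=> i j; rewrite !ffunE => /maxrankfun_inj.
- apply/injectiveP=> i j; rewrite !(ffunE (fun i => g (s i))).
  by move=> /fullrankfun_inj/perm_inj.
apply/forallP=> i; rewrite ffunE (ffunE (fun i => g (s i))).
apply: contraNT s_neq0 => /M_supp Mi0.
by apply/prodf_eq0; exists i; rewrite // mxE Mi0.
Qed.

(** If the rows chosen by [f] span the row space, then by symmetry the columns chosen by [f] span
    the column space. So [rowsub f M] factors through [mxsub f f M], which must have full rank. *)
Lemma symmetric_principal_unit (F : fieldType) n (M : 'M[F]_n) : M^T = M ->
  exists2 f : 'I_(\rank M) -> 'I_n, injective f & mxsub f f M \in unitmx.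
Proof.
move=> M_sym; pose f := maxrankfun M; exists f; first exact: maxrankfun_inj.
have [X MX] : exists X, M = X *m rowsub f M.
  by apply/submxP; rewrite eq_maxrowsub.
have BE : rowsub f M = mxsub f f M *m X^T.
  have MX' : M = (rowsub f M)^T *m X^T by rewrite -trmx_mul -MX M_sym.
  have /(congr1 (rowsub f)) := MX'; rewrite -mul_rowsub_mx => ->.
  by congr (_ *m _); apply/matrixP=> i j; rewrite !mxE -{1}M_sym mxE.
rewrite -row_free_unit /row_free eqn_leq rank_leq_row.
have := mxrankM_maxl (mxsub f f M) X^T; rewrite -BE.
by rewrite (eqP (maxrowsub_free M)).
Qed.

(** * Specialization of resultants, derivative of the characteristic polynomial *)

(** The shape of the Sylvester matrix depends on the degrees, which [f] preserves as long as the
    leading coefficients survive. *)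
Lemma rmorph_resultant (S T : nzRingType) (f : {rmorphism S -> T})
    (p q : {poly S}) :
    f (lead_coef p) != 0 -> f (lead_coef q) != 0 ->
  f (resultant p q) = resultant (map_poly f p) (map_poly f q).
Proof.
move=> fp_neq0 fq_neq0; rewrite -det_map_mx /resultant /Sylvester_mx.
rewrite !size_map_poly_id0 // map_col_mx; congr (\det (col_mx _ _));
  by apply: map_lin1_mx => v; rewrite map_poly_rV rmorphM /= map_rVpoly.
Qed.

Lemma coprimep_rmorph_resultant (S : nzRingType) (F : fieldType)
    (f : {rmorphism S -> F}) (p q : {poly S}) :
    p \is monic -> f (lead_coef q) != 0 ->
  coprimep (map_poly f p) (map_poly f q) = (f (resultant p q) != 0).
Proof.
move=> p_monic fq_neq0.
rewrite rmorph_resultant ?(monicP p_monic) ?rmorph1 ?oner_neq0 //.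
rewrite resultant_eq0 -leqNgt coprimep_def eqn_leq [X in _ && X]lt0n.
by rewrite size_poly_eq0 gcdp_eq0 (negPf (monic_neq0 (monic_map f p_monic))) andbT.
Qed.

Lemma lead_coef_deriv_monic (S : nzRingType) (p : {poly S}) m :
    p \is monic -> size p = m.+2 -> (m.+1)%:R != 0 :> S ->
  lead_coef p^`() = (m.+1)%:R.
Proof.
move=> p_monic sz_p m_neq0.
have coef_m : p^`()`_m = m.+1%:R.
  by rewrite coef_deriv; move/monicP: p_monic; rewrite lead_coefE sz_p => ->.
suff sz_p' : size p^`() = m.+1 by rewrite lead_coefE sz_p'.
apply/eqP; rewrite eqn_leq -ltnS -sz_p lt_size_deriv -?size_poly_eq0 ?sz_p //=.
by apply: contraR m_neq0; rewrite -leqNgt => sz_le; rewrite -coef_m nth_default.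
Qed.

Lemma deriv_prod (S : comNzRingType) (I : eqType) (r : seq I)
    (F : I -> {poly S}) : uniq r ->
  (\prod_(i <- r) F i)^`()
    = \sum_(i <- r) (F i)^`() * \prod_(j <- r | j != i) F j.
Proof.
elim: r => [|a r IHr] /=; first by rewrite !big_nil derivC.
case/andP=> aNr r_uniq; rewrite !big_cons eqxx derivM IHr // mulr_sumr.
congr (_ * _ + _).
  by rewrite [RHS]big_seq_cond [LHS]big_seq; apply: eq_bigl => j;
    case: eqP => [->|_]; rewrite ?(negPf aNr) ?andbT.
apply: eq_big_seq => i ir; rewrite mulrCA; congr (_ * _).
by rewrite big_cons; case: eqP => // ai; rewrite ai ir in aNr.
Qed.

(** The determinant is differentiated one row at a time: row i becomes a unit vector, along which
    one expands. Evaluated at 0, the formula ties the linear coefficient of the characteristic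
    polynomial to the principal minors of corank one. *)
Lemma deriv_char_poly (S : comNzRingType) n (M : 'M[S]_n) :
  (char_poly M)^`() = \sum_i char_poly (row' i (col' i M)).
Proof.
pose C i := \matrix_(x, y) if x == i then (i == y)%:R else char_poly_mx M x y.
transitivity (\sum_i \det (C i)).
  rewrite /char_poly /determinant exchange_big raddf_sum /=.
  apply: eq_bigr => s _; have -> : (-1) ^+ s = ((-1) ^+ s)%:P :> {poly S}.
    by rewrite rmorph_sign.
  rewrite derivM derivC mul0r add0r deriv_prod ?index_enum_uniq // mulr_sumr.
  apply: eq_bigr => i _; congr (_ * _); rewrite [RHS](bigD1 i) //=; congr (_ * _).
    by rewrite !mxE eqxx derivB derivC subr0 derivMn derivX.
  by apply: eq_bigr => j /negPf j_neq_i; rewrite [RHS]mxE j_neq_i.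
apply: eq_bigr => i _; rewrite (expand_det_row _ i) (bigD1 i) //= big1 ?addr0.
  rewrite mxE !eqxx mul1r /cofactor addnn -signr_odd odd_double mul1r.
  rewrite /char_poly -row'_col'_char_poly_mx; congr (\det _).
  by apply/matrixP=> x y; rewrite !mxE eq_sym (negPf (neq_lift _ _)).
by move=> j /negPf j_neq_i; rewrite mxE eqxx eq_sym j_neq_i mul0r.
Qed.

Lemma exists_nonroot (F : numFieldType) (p : {poly F}) :
  p != 0 -> exists x, ~~ root p x.
Proof.
move=> p_neq0; pose t := [seq i%:R : F | i <- iota 0 (size p)].
have t_uniq : uniq t.
  by rewrite map_inj_uniq ?iota_uniq // => i j /eqP; rewrite eqr_nat => /eqP.
have /allPn[x _ ?] : ~~ all (root p) t; last by exists x.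
apply/negP=> /(max_poly_roots p_neq0)/(_ t_uniq).
by rewrite size_map size_iota ltnn.
Qed.

(** * Diagonal scaling *)

Definition diag_scale (S : pzRingType) n (d : 'rV[S]_n) (M : 'M[S]_n) :=
  diag_mx d *m M *m diag_mx d.

Lemma diag_scaleE (S : comPzRingType) n (d : 'rV[S]_n) (M : 'M[S]_n) i j :
  diag_scale d M i j = d 0 i * M i j * d 0 j.
Proof.
by rewrite /diag_scale mul_diag_mx mul_mx_diag !mxE.
Qed.

Lemma tr_diag_scale (S : comPzRingType) n (d : 'rV[S]_n) (M : 'M[S]_n) :
  M^T = M -> (diag_scale d M)^T = diag_scale d M.
Proof. by move=> M_sym; rewrite !trmx_mul !tr_diag_mx M_sym mulmxA. Qed.

Lemma mxsub_diag_scale (S : comPzRingType) m n (f : 'I_m -> 'I_n)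
    (d : 'rV[S]_n) (M : 'M[S]_n) :
  mxsub f f (diag_scale d M) = diag_scale (\row_i d 0 (f i)) (mxsub f f M).
Proof. by apply/matrixP=> i j; rewrite mxE !diag_scaleE !mxE. Qed.

Lemma det_diag_scale (S : comNzRingType) n (d : 'rV[S]_n) (M : 'M[S]_n) :
  \det (diag_scale d M) = (\prod_i d 0 i) ^+ 2 * \det M.
Proof. by rewrite !det_mulmx det_diag mulrAC expr2. Qed.

Lemma horner_diag_scale (S : comNzRingType) n (d : 'rV[S]_n) (M : 'M[S]_n) x :
  map_mx (horner_eval x)
    (diag_scale (map_mx polyC d + const_mx 'X) (map_mx polyC M))
  = diag_scale (d + const_mx x) M.
Proof.
by apply/matrixP=> i j; rewrite mxE !diag_scaleE !mxE /horner_eval !hornerE.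
Qed.

(** The row [d *m rowsub f 1%:M] is d placed at the positions in the image of f, with zeros
    elsewhere; an eigenvector padded in the same way remains an eigenvector. *)
Lemma eigenvalue_diag_scale_pad (F : fieldType) m n (f : 'I_m -> 'I_n)
    (M : 'M[F]_n) (d : 'rV[F]_m) a :
    injective f -> eigenvalue (diag_scale d (mxsub f f M)) a ->
  eigenvalue (diag_scale (d *m rowsub f 1%:M) M) a.
Proof.
move=> f_inj /eigenvalueP[v vM v_neq0]; pose P : 'M[F]_(m, n) := rowsub f 1%:M.
have PPt : P *m P^T = 1%:M.
  rewrite -rowsubE; apply/matrixP=> i j; rewrite !mxE.
  by rewrite eq_sym (inj_eq f_inj).
have diagE : diag_mx (d *m P) = P^T *m diag_mx d *m P.
  apply/matrixP=> x y; rewrite mul_mx_diag [RHS]mxE !mxE.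
  rewrite (big_morph (fun z => z *+ (x == y)) (fun _ _ => mulrnDl _ _ _) (mul0rn _ _)).
  apply: eq_bigr => i _; rewrite !mxE.
  case: (f i =P x) => [<-|_]; rewrite ?mul0r ?mulr0 ?mul0rn //.
  by rewrite mul1r mulr1 mulr_natr.
have subE : mxsub f f M = P *m M *m P^T.
  by rewrite -rowsubE trmx_mxsub trmx1 mulmx_colsub mulmx1 -mxsubcr.
apply/eigenvalueP; exists (v *m P).
  rewrite /diag_scale diagE !mulmxA -(mulmxA v P) PPt mulmx1.
  by rewrite scalemxAl -vM /diag_scale subE !mulmxA.
apply: contraNneq v_neq0 => /(congr1 (mulmx^~ P^T)) /eqP.
by rewrite -mulmxA PPt mulmx1 mul0mx.
Qed.

(** * Distinct eigenvalues by scaling a nonsingular symmetric matrix *)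

Section DistinctEigenvalues.
Variable R : rcfType.

Definition distinct_nonzero_eigenvalues n (M : 'M[R]_n) (s : seq R) :=
  [&& uniq s, 0 \notin s & all (eigenvalue M) s].

Lemma symmetric_separable_eigenvalues n (M : 'M[R]_n) :
    M^T = M -> M \in unitmx -> separable_poly (char_poly M) ->
  exists2 s, distinct_nonzero_eigenvalues M s & size s = n.
Proof.
move=> /symmetric_char_poly[e charE _] M_unit M_sep.
pose s := [seq e 0 i | i <- enum 'I_n].
have charE' : char_poly M = \prod_(a <- s) ('X - a%:P).
  by rewrite charE big_map big_enum.
have eigE a : (a \in s) = eigenvalue M a.
  by rewrite eigenvalue_root_char charE' root_prod_XsubC.
exists s; last by rewrite size_map size_enum_ord.
apply/and3P; split; last by apply/allP=> a; rewrite eigE.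
  by rewrite -separable_prod_XsubC -charE'.
rewrite eigE; apply/eigenvalueP=> -[v]; rewrite scale0r => vM0.
by rewrite -(mulmxK M_unit v) vM0 mul0mx eqxx.
Qed.

(** The inner variable x of [N] moves d0 along the all-ones vector. At x, the characteristic
    polynomial is separable if it is coprime to q and to the outer ['X]. The latter is
    nonsingularity; the former is the nonvanishing at x of a resultant that is nonzero at x = 0.
    Taking e = 1 admits a double eigenvalue 0 at x = 0. *)
Lemma diag_scale_perturb n (B : 'M[R]_n.+1) (d0 : 'rV[R]_n.+1) e
    (N := diag_scale (map_mx polyC d0 + const_mx 'X) (map_mx polyC B))
    (q : {poly {poly R}}) :
    B^T = B -> B \in unitmx -> (char_poly N)^`() = q * 'X^e ->
    coprimep (char_poly (diag_scale d0 B)) (map_poly (horner_eval 0) q) ->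
  exists d s, distinct_nonzero_eigenvalues (diag_scale d B) s /\ size s = n.+1.
Proof.
move=> B_sym B_unit derivE co0; pose dx x := d0 + const_mx x.
have NE x : map_mx (horner_eval x) N = diag_scale (dx x) B.
  exact: horner_diag_scale.
have charE x : map_poly (horner_eval x) (char_poly N)
             = char_poly (diag_scale (dx x) B).
  by rewrite map_char_poly NE.
have N_monic := char_poly_monic N.
have lead_q : lead_coef q = n.+1%:R.
  rewrite -(lead_coef_deriv_monic N_monic (size_char_poly N)).
    by rewrite derivE lead_coef_Mmonic ?monicXn.
  by rewrite -polyC_natr polyC_eq0 pnatr_eq0.
have lead_q_neq0 x : horner_eval x (lead_coef q) != 0.
  by rewrite lead_q rmorph_nat pnatr_eq0.
pose rho := resultant (char_poly N) q.
have rho0 : rho != 0.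
  apply: contraTneq co0 => rho0.
  have := coprimep_rmorph_resultant N_monic (lead_q_neq0 0).
  rewrite charE (_ : dx 0 = d0); last by apply/rowP=> i; rewrite !mxE addr0.
  move=> ->.
  by rewrite -/rho rho0 rmorph0 eqxx.
(* The second factor keeps every entry of [dx x] nonzero. *)
have /exists_nonroot[x] : rho * \prod_i ('X - (- d0 0 i)%:P) != 0.
  by rewrite mulf_neq0 // monic_neq0 // monic_prod_XsubC.
rewrite rootM negb_or => /andP[rhox dx_neq0].
have scale_unit : diag_scale (dx x) B \in unitmx.
  rewrite unitmxE det_diag_scale unitfE mulf_neq0 -?unitfE // ?unitrX_pos //.
  rewrite unitfE; move: dx_neq0; apply: contraNneq => /eqP/prodf_eq0[i _].
  rewrite !mxE => /eqP di0; rewrite rootE horner_prod; apply/prodf_eq0; exists i => //.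
  by rewrite hornerXsubC opprK addrC di0.
suff sep : separable_poly (char_poly (diag_scale (dx x) B)).
  have [s] := symmetric_separable_eigenvalues (tr_diag_scale _ B_sym) scale_unit sep.
  by exists (dx x), s.
rewrite separable_poly.unlock -charE deriv_map derivE rmorphM /= map_polyXn.
rewrite coprimepMr coprimep_rmorph_resultant ?lead_q_neq0 //.
have -> : horner_eval x rho != 0 by [].
apply: coprimep_expr; rewrite -['X]subr0 coprimep_XsubC charE.
rewrite -eigenvalue_root_char; apply/eigenvalueP=> -[v]; rewrite scale0r => vM0.
by rewrite -(mulmxK scale_unit v) vM0 mul0mx eqxx.
Qed.

Lemma char_poly_distinct_roots n (M : 'M[R]_n) t :
    uniq t -> all (eigenvalue M) t -> size t = n ->
  char_poly M = \prod_(a <- t) ('X - a%:P).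
Proof.
move=> t_uniq t_eig sz_t.
rewrite (all_roots_prod_XsubC (p := char_poly M) (rs := t)).
- by rewrite (monicP (char_poly_monic M)) scale1r.
- by rewrite size_char_poly sz_t.
- by apply/allP=> a /(allP t_eig); rewrite eigenvalue_root_char.
- by rewrite uniq_rootsE.
Qed.

(** The diagonal of the inverse [C] consists of principal minors of corank one over the determinant,
    so it vanishes. With [C 0 j] nonzero, the principal minor of [C] on 0 and j is nonzero, and so
    is the complementary minor of [B]. *)
Lemma exists_principal_unit_pair n (B : 'M[R]_n.+1) :
    B^T = B -> B \in unitmx ->
    (forall i : 'I_n.+1, mxsub (lift i) (lift i) B \notin unitmx) ->
  exists m (f : 'I_m -> 'I_n.+1),
    [/\ m.+2 = n.+1, injective f & mxsub f f B \in unitmx].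
Proof.
move=> B_sym B_unit minor0; pose C := invmx B.
have C_sym i j : C i j = C j i.
  by have Ct : C^T = C by [rewrite trmx_inv B_sym]; rewrite -{1}Ct mxE.
have Cii i : C i i = 0.
  have := minor0 i; rewrite unitmxE unitfE negbK => /eqP minori.
  rewrite /C /invmx B_unit mxE mxE /cofactor.
  rewrite (_ : row' i (col' i B) = mxsub (lift i) (lift i) B) ?minori ?mulr0 //.
  by apply/matrixP=> x y; rewrite !mxE.
have [j C0j] : exists j, C 0 j != 0.
  apply/existsP; apply: contraT; rewrite negb_exists => /forallP C0.
  have : row 0 C *m B = 0.
    rewrite (_ : row 0 C = 0) ?mul0mx //.
    by apply/rowP=> j; rewrite !mxE; apply/eqP/negbNE.
  rewrite -row_mul mulVmx // => /rowP/(_ 0); rewrite !mxE eqxx => /eqP.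
  by rewrite oner_eq0.
have j_neq0 : 0 != j by apply: contraNneq C0j => <-; rewrite Cii.
case: (unliftP 0 j) => [j' jE|j0]; last by rewrite j0 eqxx in j_neq0.
case: n => [|n] in B B_sym B_unit minor0 C C_sym Cii j C0j j_neq0 j' jE *.
  by case: j' jE.
pose f x := lift 0 (lift j' x).
have f_inj : injective f by move=> x y /lift_inj/lift_inj.
have f_neq0 x : (f x == 0) = false by rewrite eq_sym (negPf (neq_lift _ _)).
have f_neqj x : (f x == j) = false.
  by rewrite jE (inj_eq (@lift_inj _ _)) eq_sym (negPf (neq_lift _ _)).
have f_onto y : y != 0 -> y != j -> exists x, y = f x.
  case: (unliftP 0 y) => [y' ->|->]; last by rewrite eqxx.
  move=> _; rewrite jE (inj_eq (@lift_inj _ _)).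
  by case: (unliftP j' y') => [x ->|->]; [exists x|rewrite eqxx].
exists n, f; split=> //; rewrite -row_free_unit -kermx_eq0.
apply/rowV0P=> v /sub_kermxP vB0.
pose P : 'M[R]_(n, n.+2) := rowsub f 1%:M.
(* For v in the kernel, [w] is supported on 0 and j, while [w *m C], being the padding of v,
   vanishes there. As [C] has zero diagonal, this reads [w 0 j * C j 0 = 0] and
   [w 0 0 * C 0 j = 0]. *)
pose w := v *m P *m B.
have wf x : w 0 (f x) = 0.
  rewrite -[RHS](_ : (v *m mxsub f f B) 0 x = 0); last by rewrite vB0 mxE.
  rewrite /w -mulmxA -rowsubE !mxE; apply: eq_bigr => y _; by rewrite !mxE.
have wC : v *m P = w *m C by rewrite mulmxK.
have vP0 y : (forall x, f x != y) -> (v *m P) 0 y = 0.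
  move=> yNf; rewrite mxE big1 // => x _; rewrite !mxE.
  by rewrite (negPf (yNf x)) mulr0.
have wCE y : (w *m C) 0 y = w 0 0 * C 0 y + w 0 j * C j y.
  rewrite mxE (bigD1 0) //= (bigD1 j) 1?eq_sym //= big1 ?addr0 // => z /andP[z0 zj].
  by have [x ->] := f_onto z z0 zj; rewrite wf mul0r.
have w0 : w = 0.
  have wj0 : w 0 j = 0.
    have := wCE 0; rewrite -wC vP0 ?Cii ?mulr0 ?add0r;
      last by move=> x; rewrite f_neq0.
    by move/esym/eqP; rewrite mulf_eq0 (C_sym j) (negPf C0j) orbF => /eqP.
  have w00 : w 0 0 = 0.
    have := wCE j; rewrite -wC vP0 ?Cii ?mulr0 ?addr0;
      last by move=> x; rewrite f_neqj.
    by move/esym/eqP; rewrite mulf_eq0 (negPf C0j) orbF => /eqP.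
  apply/rowP=> y; rewrite [RHS]mxE.
  have [->|y0] := eqVneq y 0; first exact: w00.
  have [->|yj] := eqVneq y j; first exact: wj0.
  by have [x ->] := f_onto y y0 yj.
apply/rowP=> x; rewrite [RHS]mxE; transitivity ((v *m P) 0 (f x)).
  rewrite mxE (bigD1 x) //= big1 ?addr0 => [|y yx]; rewrite !mxE.
    by rewrite eqxx mulr1.
  by rewrite (inj_eq f_inj) (negPf yx) mulr0.
by rewrite wC w0 mul0mx mxE.
Qed.

Lemma coprimep_deriv_prod_XsubC (s : seq R) (h := \prod_(a <- s) ('X - a%:P)) :
  coprimep h h^`() = uniq s.
Proof. by rewrite -separable_prod_XsubC separable_poly.unlock. Qed.

Lemma double_root_factor (p : {poly R}) s :
    p \is monic -> uniq s -> 0 \notin s -> all (root p) s ->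
    size p = (size s).+3 -> root p 0 -> root p^`() 0 ->
  p = 'X^2 * \prod_(a <- s) ('X - a%:P).
Proof.
move=> p_monic s_uniq s0 s_root sz_p p0 p'0; set h := \prod_(a <- s) _.
have h_monic : h \is monic by exact: monic_prod_XsubC.
have X2p : 'X^2 %| p.
  have /factor_theorem[g pE] := p0; move: p'0; rewrite pE derivM derivXsubC.
  rewrite mulr1 rootE hornerD hornerM hornerXsubC subrr mulr0 add0r.
  case/factor_theorem=> g' ->.
  by rewrite subr0 -mulrA dvdp_mull.
have hp : h %| p by rewrite uniq_roots_dvdp // uniq_rootsE.
have co_Xh : coprimep 'X^2 h.
  by rewrite coprimep_expl // coprimep_sym -['X]subr0 coprimep_XsubC root_prod_XsubC.
have Xh_monic : 'X^2 * h \is monic by rewrite (monicMl _ (monicXn _ 2)).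
apply/eqP; rewrite eq_sym -eqp_monic // -dvdp_size_eqp.
  rewrite size_monicM ?(monicXn _ 2) ?monic_neq0 //.
  by rewrite size_polyXn size_prod_XsubC sz_p.
by rewrite Gauss_dvdp // X2p.
Qed.

(** Here q is X h' + 2 h. Its value at 0 is 2 h(0), which is nonzero, and modulo h it is X h', which
    is coprime to h. *)
Lemma coprimep_double_root (s : seq R) (h := \prod_(a <- s) ('X - a%:P)) q :
    uniq s -> 0 \notin s -> ('X^2 * h)^`() = q * 'X ->
  coprimep ('X^2 * h) q.
Proof.
move=> s_uniq s0 derivE; have h0 : ~~ root h 0 by rewrite root_prod_XsubC.
have co_hX : coprimep h 'X by rewrite -['X]subr0 coprimep_XsubC.
have qE : q = 'X * h^`() + 2 * h.
  apply: (mulIf (x := 'X)); rewrite ?polyX_eq0 // -derivE derivM derivXn /=.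
  by rewrite expr1; ring.
rewrite coprimepMl coprimep_expl; last first.
  rewrite coprimep_sym -['X]subr0 coprimep_XsubC qE rootE hornerD !hornerM.
  by rewrite hornerX mul0r add0r -[2]polyC_natr hornerC mulf_neq0 ?pnatr_eq0.
rewrite /= qE addrC [_ * h^`()]mulrC coprimep_addl_mul coprimepMr co_hX andbT.
by rewrite -coprimep_deriv_prod_XsubC in s_uniq.
Qed.

Lemma diag_scale_distinct_eigenvalues n (B : 'M[R]_n) :
    B^T = B -> B \in unitmx ->
  exists d s, distinct_nonzero_eigenvalues (diag_scale d B) s /\ size s = n.
Proof.
have [N] := ubnP n; elim: N n B => // N IHN [|n] B; rewrite ltnS => nN B_sym B_unit.
  by exists 0, [::].
(* Since [f] misses an index, the padded diagonal has a zero entry, whence the zero determinant. *)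
have IH m (f : 'I_m -> 'I_n.+1) : (m < n.+1)%N -> injective f ->
    mxsub f f B \in unitmx -> exists d0 s,
    [/\ distinct_nonzero_eigenvalues (diag_scale d0 B) s, size s = m
       & \det (diag_scale d0 B) = 0].
  move=> lt_mn f_inj f_unit.
  have [||d [s [/and3P[s_uniq s0 s_eig] sz_s]]] := IHN m (mxsub f f B) _ _ f_unit.
  - exact: leq_trans lt_mn nN.
  - by rewrite trmx_mxsub B_sym.
  exists (d *m rowsub f 1%:M), s; split=> //.
    apply/and3P; split=> //; apply/allP=> a /(allP s_eig).
    exact: eigenvalue_diag_scale_pad.
  rewrite det_diag_scale; have [i iNf] : exists i, forall x, f x != i.
    have /subsetPn[i _ iNf] : ~~ ([set: 'I_n.+1] \subset codom f).
      apply/negP=> /subset_leq_card; rewrite cardsT card_codom // !card_ord.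
      by rewrite leqNgt lt_mn.
    by exists i => x; apply: contraNneq iNf => <-; exact: codom_f.
  rewrite (bigD1 i) //= mxE big1 ?mul0r ?expr0n ?mul0r // => x _.
  by rewrite !mxE (negPf (iNf x)) mulr0.
have eig0 (M : 'M[R]_n.+1) : \det M = 0 -> eigenvalue M 0.
  move=> /eqP/det0P[v v_neq0 vM0]; apply/eigenvalueP; exists v => //.
  by rewrite scale0r.
pose N0 d0 := diag_scale (map_mx polyC d0 + const_mx 'X) (map_mx polyC B).
have charN0 d0 : map_poly (horner_eval 0) (char_poly (N0 d0))
               = char_poly (diag_scale d0 B).
  have d0E : d0 + const_mx 0 = d0 by apply/rowP=> i; rewrite !mxE addr0.
  have NE : map_mx (horner_eval 0) (N0 d0) = diag_scale d0 B.
    by rewrite -[in RHS]d0E; exact: horner_diag_scale.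
  by rewrite map_char_poly NE.
have [/existsP[i i_unit]|] :=
    boolP [exists i : 'I_n.+1, mxsub (lift i) (lift i) B \in unitmx].
  have [d0 [s [/and3P[s_uniq s0 s_eig] sz_s detN0]]] :=
    IH _ _ (leqnn _) (@lift_inj _ i) i_unit.
  (* Corank one: [0 :: s] lists n + 1 distinct eigenvalues, so separability holds already at d0. *)
  apply: (diag_scale_perturb (e := 0) (d0 := d0)
    (q := (char_poly (N0 d0))^`())) => //.
    by rewrite mulr1.
  rewrite -deriv_map charN0 (char_poly_distinct_roots (t := 0 :: s)) /=
    ?s0 ?sz_s ?eig0 //.
  by rewrite coprimep_deriv_prod_XsubC /= s0.
rewrite negb_exists => /forallP minor0.
have [m [f [mn f_inj f_unit]]] := exists_principal_unit_pair B_sym B_unit minor0.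
have [d0 [s [/and3P[s_uniq s0 s_eig] sz_s detN0]]] :=
  IH _ _ (ltnW (eq_leq mn)) f_inj f_unit.
(* Corank two: every principal minor of corank one of [N0 d0] is a multiple of one of [B], hence 0.
   So ['X] divides the derivative over the whole family, not only at d0. *)
have /factor_theorem[q] : root (char_poly (N0 d0))^`() 0.
  rewrite rootE deriv_char_poly horner_sum big1 // => i _.
  rewrite horner_coef0 char_poly_det.
  have -> : row' i (col' i (N0 d0)) = mxsub (lift i) (lift i) (N0 d0).
    by apply/matrixP=> x y; rewrite !mxE.
  rewrite mxsub_diag_scale det_diag_scale -map_mxsub det_map_mx.
  by have := minor0 i; rewrite unitmxE unitfE negbK => /eqP->; rewrite rmorph0 !mulr0.
rewrite subr0 => derivE.
have q0E : (char_poly (diag_scale d0 B))^`() = map_poly (horner_eval 0) q * 'X.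
  by rewrite -charN0 deriv_map derivE rmorphM /= map_polyX.
apply: (diag_scale_perturb (e := 1) (d0 := d0) (q := q)) => //.
have := q0E.
rewrite (double_root_factor (char_poly_monic (diag_scale d0 B)) s_uniq s0).
- exact: coprimep_double_root.
- by apply/allP=> a /(allP s_eig); rewrite eigenvalue_root_char.
- by rewrite size_char_poly sz_s mn.
- by rewrite -eigenvalue_root_char eig0.
- by rewrite q0E rootM rootX eqxx orbT.
Qed.
End DistinctEigenvalues.

(** * Separability criterion for k nonzero simple eigenvalues *)

Section Criterion.
Variable R : rcfType.

Lemma symmetric_scaled_distinct_eigenvalues n (M : 'M[R]_n) : M^T = M ->
  exists d s, distinct_nonzero_eigenvalues (diag_scale d M) s
              /\ size s = \rank M.
Proof.
move=> M_sym; have [f f_inj f_unit] := symmetric_principal_unit M_sym.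
have [|d [s [/and3P[s_uniq s0 s_eig] sz_s]]] :=
  diag_scale_distinct_eigenvalues _ f_unit; first by rewrite trmx_mxsub M_sym.
exists (d *m rowsub f 1%:M), s; split=> //; apply/and3P; split=> //.
by apply/allP=> a /(allP s_eig); exact: eigenvalue_diag_scale_pad.
Qed.

Lemma polyXn_prod (F : nzRingType) m :
  'X^m = \prod_(a <- nseq m 0) ('X - a%:P) :> {poly F}.
Proof. by elim: m => [|m IHm]; rewrite ?big_nil //= big_cons -IHm subr0 exprS. Qed.

Lemma monic_drop_poly (S : nzRingType) m (p : {poly S}) :
  p \is monic -> (m < size p)%N -> drop_poly m p \is monic.
Proof.
move=> /monicP p_monic lt_m_p; apply/monicP; rewrite -[RHS]p_monic !lead_coefE.
rewrite coef_drop_poly size_drop_poly; congr (_`_ _).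
by move: lt_m_p; case: (size p) => // sz lt_m; rewrite subSn //= subnK.
Qed.

(* Once the factor 'X^(n - k) forced by the rank is removed, separability of
   the rest multiplied by 'X excludes both repeated and zero roots. *)
Definition reduced_char_poly (S : nzRingType) n (M : 'M[S]_n) k :=
  'X * drop_poly (n - k) (char_poly M).

(** The list [u] holds the nonzero eigenvalues with multiplicity. The root 0 is left k - size u + 1
    times, so separability will force size u = k. *)
Lemma reduced_char_polyE n (M : 'M[R]_n) k :
    M^T = M -> (\rank M <= k)%N -> (k <= n)%N ->
  exists u, [/\ 0 \notin u, (size u <= k)%N,
    char_poly M = \prod_(a <- nseq (n - size u) 0 ++ u) ('X - a%:P) &
    reduced_char_poly M k
      = \prod_(a <- nseq (k - size u).+1 0 ++ u) ('X - a%:P)].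
Proof.
move=> M_sym M_rank le_kn.
have [u [u0 /leq_trans/(_ M_rank) le_uk charE]] := symmetric_char_polyX M_sym.
exists u; split=> //; first by rewrite big_cat -polyXn_prod.
rewrite big_cat -polyXn_prod /= exprS -mulrA /reduced_char_poly; congr (_ * _).
rewrite charE; have -> : (n - size u = (k - size u) + (n - k))%N.
  by rewrite addnC addnBA // subnK.
by rewrite exprD mulrAC drop_polyMXn_id.
Qed.

Lemma coprimep_reduced_char_poly n (M : 'M[R]_n) k
    (w := reduced_char_poly M k) s :
    M^T = M -> (\rank M <= k)%N -> (k <= n)%N ->
    distinct_nonzero_eigenvalues M s -> size s = k ->
  coprimep w w^`().
Proof.
move=> M_sym M_rank le_kn /and3P[s_uniq s0 s_eig] sz_s.
have [u [u0 le_uk charE wE]] := reduced_char_polyE M_sym M_rank le_kn.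
(* A duplicate-free s of size k inside u, of size at most k, forces u to be duplicate-free of size
   k. *)
have su : {subset s <= u}.
  move=> a sa; have := allP s_eig _ sa; rewrite eigenvalue_root_char charE.
  rewrite root_prod_XsubC mem_cat mem_nseq => /orP[/andP[_ /eqP a0]|//].
  by rewrite -a0 sa in s0.
have sz_u : size u = k.
  by apply/eqP; rewrite eqn_leq le_uk -sz_s uniq_leq_size.
rewrite /w wE coprimep_deriv_prod_XsubC sz_u subnn /= u0.
by apply: leq_size_uniq s_uniq su _; rewrite sz_u sz_s.
Qed.
End Criterion.

Lemma has_nonzero_simple_eigenvalues_coprimep (R : realType) n (M : 'M[R]_n) k
    (w := reduced_char_poly M k) :
    M^T = M -> (\rank M <= k)%N -> (k <= n)%N -> coprimep w w^`() ->
  has_nonzero_simple_eigenvalues M k.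
Proof.
move=> M_sym M_rank le_kn.
have [u [u0 le_uk charE wE]] := reduced_char_polyE M_sym M_rank le_kn.
rewrite /w wE coprimep_deriv_prod_XsubC cat_uniq => /and3P[nseq_uniq _ u_uniq].
have sz_u : size u = k.
  apply/eqP; rewrite eqn_leq le_uk -subn_eq0.
  by case: (k - size u)%N nseq_uniq => // m; rewrite /= mem_head.
exists u; split=> // a; have [->|a_neq0] := eqVneq a 0; first exact: negPf.
rewrite /simple_eigenvalue eigenvalue_root_char charE mu_prod_XsubC.
rewrite root_prod_XsubC count_cat mem_cat mem_nseq (negPf a_neq0) andbF /=.
rewrite (count_uniq_mem _ u_uniq) (_ : count_mem a _ = 0%N); last first.
  by apply/count_memPn; rewrite mem_nseq (negPf a_neq0) andbF.
by case: (a \in u).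
Qed.

(** * A good realization, and the resultant as a polynomial in the parameters *)

Lemma exists_realization_distinct (R : realType) n (A : 'M[bool]_n) :
    sym_structured A ->
  exists (p : 'rV[R]_(nparam A)) s,
    distinct_nonzero_eigenvalues (realization p) s /\ size s = term_rank A.
Proof.
move=> A_sym; have [/existsP[r /existsP[c matching]] max_matching] := term_rankP A.
case/and3P: matching => /injectiveP r_inj /injectiveP c_inj /forallP rcA.
pose E := [set (r l, c l) | l : 'I_(term_rank A)].
have cardE : #|E| = term_rank A.
  by rewrite card_imset ?card_ord // => l l' [/r_inj].
have [||M [M_sym M_supp M_rank]] := @rank_symmetric_matching R n E.
- by move=> _ _ /imsetP[l _ ->] /imsetP[l' _ ->] /= /r_inj->.
- by move=> _ _ /imsetP[l _ ->] /imsetP[l' _ ->] /= /c_inj->.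
have M_zero i j : ~~ A i j -> M i j = 0.
  move=> AijF; apply/eqP; apply: contraNT AijF => /M_supp.
  by case/orP=> /imsetP[l _ [-> ->]]; rewrite // A_sym.
have rankE : \rank M = term_rank A.
  apply/eqP; rewrite eqn_leq -{2}cardE M_rank andbT.
  exact/max_matching/has_star_matching_rank.
have [d [s [s_eig sz_s]]] := symmetric_scaled_distinct_eigenvalues M_sym.
have [|p pE] := (realizationP (diag_scale d M) A_sym).2.
  split=> i j; first by rewrite -[in LHS](tr_diag_scale d M_sym) mxE.
  by move=> /M_zero Mij; rewrite diag_scaleE Mij mulr0 mul0r.
by exists p, s; rewrite -pE sz_s rankE.
Qed.

Definition generic_realization (R : realType) n (A : 'M[bool]_n) :
    'M[{mpoly R[nparam A]}]_n :=
  \matrix_(i, j)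
    if insub (upper_pos i j) is Some t then 'X_(enum_rank (t : param A)) else 0.

Lemma meval_generic_realization (R : realType) n (A : 'M[bool]_n)
    (p : 'rV[R]_(nparam A)) :
  map_mx (meval (fun i => p 0 i)) (generic_realization R A) = realization p.
Proof.
apply/matrixP=> i j; rewrite !mxE; case: insub => [t|].
  by rewrite mevalXU.
exact: rmorph0.
Qed.

Lemma map_reduced_char_poly (S T : nzRingType) (f : {rmorphism S -> T}) n
    (M : 'M[S]_n) k :
  map_poly f (reduced_char_poly M k) = reduced_char_poly (map_mx f M) k.
Proof.
rewrite /reduced_char_poly rmorphM /= map_polyX -map_char_poly.
by congr (_ * _); apply/polyP=> i; rewrite coef_map !coef_drop_poly coef_map.
Qed.

Theorem lemma2 (R : realType) (n : nat) (A : 'M[bool]_n) (k : nat)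
    (A_sym : sym_structured A) (A_rank : term_rank A = k) :
  exists V1 : 'rV[R]_(nparam A) -> Prop,
    proper_variety V1 /\
    forall p : 'rV[R]_(nparam A), ~ V1 p ->
      has_nonzero_simple_eigenvalues (realization p) k.
Proof.
pose w := reduced_char_poly (generic_realization R A) k.
pose f := resultant w w^`().
have sym_real p : (@realization R n A p)^T = realization p.
  have [/(_ (ex_intro _ p erefl))[p_sym _] _] := realizationP (realization p) A_sym.
  by apply/matrixP=> i j; rewrite mxE.
have rank_real p : (\rank (@realization R n A p) <= k)%N.
  have [/(_ (ex_intro _ p erefl))[_ p_zero] _] := realizationP (realization p) A_sym.
  by rewrite -A_rank; apply: (term_rankP A).2; exact: has_star_matching_rank.
have [p0 [s [s_eig sz_s]]] := exists_realization_distinct R A_sym.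
rewrite A_rank in sz_s.
have le_kn : (k <= n)%N.
  have [/existsP[r /existsP[c /and3P[/injectiveP r_inj _ _]]] _] := term_rankP A.
  by rewrite -A_rank; have := leq_card r r_inj; rewrite !card_ord.
have q_monic : drop_poly (n - k) (char_poly (generic_realization R A)) \is monic.
  by rewrite monic_drop_poly ?char_poly_monic // size_char_poly ltnS leq_subr.
have w_monic : w \is monic by rewrite monicMl ?monicX.
(* As w has degree k + 1, its derivative has leading coefficient k + 1, a nonzero constant kept by
   every evaluation; hence the resultant commutes with evaluation. *)
have sz_w : size w = k.+2.
  rewrite size_monicM ?monicX ?monic_neq0 // size_polyX size_drop_poly.
  by rewrite size_char_poly subSn ?leq_subr // subKn.
have fE (p : 'rV[R]_(nparam A)) : f.@[fun i => p 0 i] != 0 =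
    coprimep (reduced_char_poly (realization p) k)
             (reduced_char_poly (realization p) k)^`().
  rewrite -meval_generic_realization -map_reduced_char_poly deriv_map.
  rewrite coprimep_rmorph_resultant // (lead_coef_deriv_monic w_monic sz_w).
    by rewrite rmorph_nat pnatr_eq0.
  by rewrite -mpolyC_nat mpolyC_eq0 pnatr_eq0.
exists (fun p => f.@[fun i => p 0 i] = 0); split; last first.
  move=> p /eqP; rewrite fE; exact: has_nonzero_simple_eigenvalues_coprimep.
split.
  exists [:: f] => p; split=> [fp g|]; first by rewrite inE => /eqP->.
  by apply; rewrite inE.
(* The set is proper because [p0] has k distinct nonzero eigenvalues, which makes the resultant
   nonzero there. *)
by exists p0; apply/eqP; rewrite fE; apply: coprimep_reduced_char_poly s_eig sz_s.
Qed.
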